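(* Let $m,k,n$ be integers with $k\in\{1,\dots,m-2\}$ and $n\ge 6$. Consider approval elections with a set $N$ of $n$ agents and a set $A$ of $m$ alternatives, where the outcome must always be a committee of size $k$. Then there is no multi-winner approval-based voting rule that is both strongly group-strategyproof and Pareto-efficient.
   Context: An approval profile is a tuple $P=(P_i)_{i\in N}$ with $P_i\subseteq A$ an arbitrary subset (agent $i$'s approval ballot/preference; any size, including empty, is allowed). A committee of size $k$ is a set $S\subseteq A$ with $|S|=k$. A multi-winner approval-based voting rule $R$ is a (deterministic) function assigning to every approval profile $P$ a committee $R(P)$ of size $k$. For $Q,T\subseteq A$ the Hamming distance is $d(Q,T)=|Q\setminus T|+|T\setminus Q|$. For $S\subseteq N$, $P_S$ and $P_{-S}$ denote the restrictions of the profile $P$ to the agents in $S$ and to the agents not in $S$, respectively. $R$ is strongly group-strategyproof if for every profile $P$ and every coalition $S\subseteq N$ there is no profile $P'_S$ of ballots of the agents in $S$ such that $d(P_i,R(P_S,P_{-S}))\ge d(P_i,R(P'_S,P_{-S}))$ for every $i\in S$, with strict inequality for at least one $i\in S$. $R$ is Pareto-efficient if for every profile $P$ there is no committee $S'$ of size $k$ such that $d(P_i,S')\le d(P_i,R(P))$ for all $i\in N$, with strict inequality for at least one $i\in N$. *)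

(* Defs.v *)
From mathcomp Require Import all_boot.

Set Implicit Arguments.
Unset Strict Implicit.
Unset Printing Implicit Defensive.

Section Approval.
Variables N A : finType.

Definition profile := {ffun N -> {set A}}.

Definition committee (k : nat) (S : {set A}) : Prop := #|S| = k.

Definition voting_rule (k : nat) (R : profile -> {set A}) : Prop :=
  forall P : profile, committee k (R P).

Definition hamming (Q T : {set A}) : nat := #|Q :\: T| + #|T :\: Q|.

(* The profile (P'_S, P_{-S}): the partial profile P'_S is represented by a
   full profile P' whose ballots outside S are ignored. *)
Definition deviate (S : {set N}) (P' P : profile) : profile :=
  [ffun i => if i \in S then P' i else P i].

Definition strongly_group_strategyproof (R : profile -> {set A}) : Prop :=
  forall (P : profile) (S : {set N}),
    ~ exists P' : profile,
        (forall i, i \in S ->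
           hamming (P i) (R P) >= hamming (P i) (R (deviate S P' P))) /\
        (exists i, i \in S /\
           hamming (P i) (R P) > hamming (P i) (R (deviate S P' P))).

Definition pareto_efficient (k : nat) (R : profile -> {set A}) : Prop :=
  forall P : profile,
    ~ exists S' : {set A},
        committee k S' /\
        (forall i, hamming (P i) S' <= hamming (P i) (R P)) /\
        (exists i, hamming (P i) S' < hamming (P i) (R P)).

End Approval.

(* Main.v *)
Require Import Defs.
From mathcomp Require Import all_boot.
From mathcomp Require Import zify.

(** Among committees of the same size, an agent ranks outcomes by the number of
    approved members.  Fix a set [B] of [k - 1] alternatives approved by
    everybody and an agent [o] approving nothing else: Pareto-efficiency then
    forces the outcome to be [B] plus one alternative, and the problem behaves
    like the election of a single winner.  Let three agents approve,
    besides [B], exactly [a], [b] and [c] respectively; by symmetry say [a]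
    wins.  If the [a]-agent approves [a, b] instead, then [a] is dominated by
    [b], and [c] cannot win because that agent could return to [a]; so [b] wins.
    Likewise [c] wins when she approves [a, c].  When she approves [a, b, c],
    the winner is [b] or [c], and, being indifferent, she can switch it to the
    other one, to the benefit of one of the other two agents. *)

Section RuleWithCommonBase.
Set Implicit Arguments.
Unset Strict Implicit.
Variables (N A : finType).
Implicit Types (P Q : profile N A) (R : profile N A -> {set A}).
Implicit Types (B C S T X : {set A}).

Lemma hammingE C S : hamming C S + (#|C :&: S|).*2 = #|C| + #|S|.
Proof.
rewrite /hamming -(cardsID S C) -(cardsID C S) (setIC S C); lia.
Qed.

Lemma leq_hamming C S T : #|S| = #|T| ->
  (hamming C S <= hamming C T) = (#|C :&: T| <= #|C :&: S|).
Proof. by move=> eST; have := hammingE C S; have := hammingE C T; lia. Qed.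

Lemma ltn_hamming C S T : #|S| = #|T| ->
  (hamming C S < hamming C T) = (#|C :&: T| < #|C :&: S|).
Proof. by move=> eST; rewrite !ltnNge leq_hamming. Qed.

Lemma cardsIU1 C S x : x \notin S -> #|C :&: (x |: S)| = (x \in C) + #|C :&: S|.
Proof.
move=> xS; rewrite setIUr cardsU setIACA setIid (_ : [set x] :&: S = set0).
  rewrite setI0 cards0 subn0; congr (_ + _).
  case: (boolP (x \in C)) => xC; first by rewrite (setIidPr _) ?sub1set // cards1.
  by apply/eqP; rewrite cards_eq0 setI_eq0 disjoint_sym disjoints1.
by apply/eqP; rewrite setI_eq0 disjoints1.
Qed.

Lemma leq_hammingU1 C S x y : x \notin S -> y \notin S ->
  (hamming C (x |: S) <= hamming C (y |: S)) = (y \in C) ==> (x \in C).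
Proof.
move=> xS yS; rewrite leq_hamming ?cardsU1 ?xS ?yS // !cardsIU1 //.
by case: (x \in C); case: (y \in C) => /=; lia.
Qed.

Lemma ltn_hammingU1 C S x y : x \notin S -> y \notin S ->
  (hamming C (x |: S) < hamming C (y |: S)) = (x \in C) && (y \notin C).
Proof. by move=> xS yS; rewrite ltnNge leq_hammingU1 // negb_imply. Qed.

(** Otherwise replacing [x] by [y] in the committee would hurt nobody and strictly help [t]. *)
Lemma pareto_swap k R P x y (t : N) : voting_rule k R -> pareto_efficient k R ->
    x \in R P -> y \notin R P -> (forall i, x \in P i -> y \in P i) ->
  y \in P t -> x \in P t.
Proof.
move=> vR pR xR yR sxy yt; apply/negPn/negP => xt.
have ySx : y \notin R P :\ x by rewrite !inE negb_and yR orbT.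
have xSx : x \notin R P :\ x by rewrite !inE eqxx.
apply: (pR P); exists (y |: R P :\ x); split; last split.
- by rewrite /committee cardsU1 ySx -(vR P) (cardsD1 x (R P)) xR.
- move=> i; rewrite -{2}(setD1K xR) leq_hammingU1 //.
  exact/implyP/sxy.
- by exists t; rewrite -{2}(setD1K xR) ltn_hammingU1 // yt.
Qed.

(* Agents whose ballot is unchanged may join the coalition, so that a deviation
   of [i] alone at no cost to her must not benefit anybody. *)
Lemma unilateral_sgsp R P Q (i t : N) : strongly_group_strategyproof R ->
    (forall j, j != i -> Q j = P j) ->
    hamming (P i) (R Q) <= hamming (P i) (R P) ->
  hamming (P t) (R P) <= hamming (P t) (R Q).
Proof.
move=> gR eQ le_i; rewrite leqNgt; apply/negP => lt_t.
have eD : deviate [set i; t] Q P = Q.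
  apply/ffunP => j; rewrite ffunE !inE.
  by case: eqVneq => //= ji; case: eqVneq => //= _; rewrite eQ.
apply: (gR P [set i; t]); exists Q; rewrite eD; split.
- by move=> j; rewrite !inE => /orP[]/eqP->; rewrite // ltnW.
- by exists t; rewrite !inE eqxx orbT.
Qed.

Variables (k : nat) (R : profile N A -> {set A}).
Hypotheses (vR : voting_rule k R) (gR : strongly_group_strategyproof R)
           (pR : pareto_efficient k R).
Variables (B : {set A}) (o : N).
Hypothesis (kB : k = #|B|.+1).

(** By counting, some [x] outside [B] is elected. If a member of [B] were missing, trading [x] for
    it would be a Pareto improvement thanks to [o], who does not approve [x]. If nobody approved
    [x], trading it for [y] would be one thanks to [t]. *)
Lemma outcome_common_base P y t : P o = B -> (forall i, B \subset P i) ->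
    y \notin B -> y \in P t ->
  exists x u, [/\ x \notin B, R P = x |: B & x \in P u].
Proof.
move=> Po BP yB yt.
have ltBR : #|B| < #|R P| by rewrite (vR P) kB.
have [x xR xB] : exists2 x, x \in R P & x \notin B.
  by apply/subsetPn/negP => /subset_leq_card; rewrite leqNgt ltBR.
have BR : B \subset R P.
  apply/subsetP => z zB; apply/negPn/negP => zR.
  suff: x \in P o by rewrite Po (negPf xB).
  apply: (@pareto_swap k R P x z o) => // [i _|]; last by rewrite Po.
  exact: (subsetP (BP i)).
have eR : R P = x |: B.
  apply/eqP; rewrite eq_sym eqEcard subUset sub1set xR BR.
  by rewrite cardsU1 xB (vR P) kB add1n leqnn.
have [u xu|xP] := pickP (fun u => x \in P u); first by exists x, u.
suff: x \in P t by rewrite xP.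
apply: (@pareto_swap k R P x y t) => //; last by move=> i; rewrite xP.
by rewrite eR !inE (negPf yB) orbF; apply: contraTneq yt => ->; rewrite xP.
Qed.

(** The hypotheses are symmetric in the pairs [(a, i)], [(b, j)], [(c, l)], so permuting them
    excludes the other two winners as well. *)
Lemma outcome_neq_singleton P (a b c : A) (i j l : N) : uniq [:: a; b; c] ->
    uniq [:: i; j; l; o] -> a \notin B -> b \notin B -> c \notin B ->
    P i = a |: B -> P j = b |: B -> P l = c |: B ->
    (forall t, t \notin [:: i; j; l] -> P t = B) ->
  R P <> a |: B.
Proof.
rewrite /= !inE !negb_or !andbT => /andP[/andP[ab ac] bc].
move=> /and3P[/and3P[ij il io] /andP[jl jo] lo] aB bB cB Pi Pj Pl Pt RP.
(* These profiles, and [P] itself, differ only in the ballot of [i], so she can pass from any one to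
   any other on her own. *)
pose Q X : profile N A := [ffun t => if t == i then X :|: B else P t].
have Qi X : Q X i = X :|: B by rewrite ffunE eqxx.
have QE X t : t != i -> Q X t = P t by rewrite ffunE => /negPf->.
have QQ X Y t : t != i -> Q X t = Q Y t by move=> ti; rewrite !QE.
have Qj X : Q X j = b |: B by rewrite QE // eq_sym.
have Ql X : Q X l = c |: B by rewrite QE // eq_sym.
have Qt X t : t \notin [:: i; j; l] -> Q X t = B.
  by move=> nt; rewrite QE ?Pt //; move: nt; rewrite inE negb_or => /andP[].
have Qo X : Q X o = B.
  by rewrite Qt // !inE !negb_or ![o == _]eq_sym io jo lo.
have BQ X t : B \subset Q X t.
  have [->|ti] := eqVneq t i; first by rewrite Qi subsetUr.
  have [->|tj] := eqVneq t j; first by rewrite Qj subsetUr.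
  have [->|tl] := eqVneq t l; first by rewrite Ql subsetUr.
  by rewrite Qt // !inE !negb_or ti tj.
have bQj X : b \in Q X j by rewrite Qj setU11.
have cQl X : c \in Q X l by rewrite Ql setU11.
(* [a] never wins, as it is dominated by whichever of [b], [c] lies in [X] *)
have outcome (X : {set A}) : X \subset [set a; b; c] -> (b \in X) || (c \in X) ->
    R (Q X) = b |: B \/ R (Q X) = c |: B.
  move=> sX bcX.
  have [x [u [xB eR xu]]] := @outcome_common_base (Q X) b j (Qo X) (BQ X) bB (bQj X).
  have aQ t : a \in Q X t -> t = i.
    apply: contraTeq => ti; rewrite QE //.
    have [->|tj] := eqVneq t j; first by rewrite Pj !inE (negPf ab) (negPf aB).
    have [->|tl] := eqVneq t l; first by rewrite Pl !inE (negPf ac) (negPf aB).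
    by rewrite Pt ?aB // !inE !negb_or ti tj.
  have : x \in [set a; b; c].
    have [ui|ui] := eqVneq u i.
      move: xu; rewrite ui Qi inE (negPf xB) orbF.
      exact: (subsetP sX).
    have [uj|uj] := eqVneq u j.
      by move: xu; rewrite uj Qj !inE (negPf xB) orbF => /eqP->; rewrite eqxx orbT.
    have [ul|ul] := eqVneq u l.
      by move: xu; rewrite ul Ql !inE (negPf xB) orbF => /eqP->; rewrite eqxx orbT.
    by move: xu; rewrite Qt ?(negPf xB) // !inE !negb_or ui uj.
  rewrite !inE -orbA => /or3P[]/eqP ex; [|by left; rewrite eR ex|by right; rewrite eR ex].
  rewrite ex in eR => {x xB xu ex}.
  have aR : a \in R (Q X) by rewrite eR setU11.
  (* Only [i] approves [a], and she approves [b] or [c] too; by [pareto_swap], [j] or [l] would then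
     approve [a]. *)
  case/orP: bcX => yX.
    have bR : b \notin R (Q X) by rewrite eR !inE negb_or eq_sym ab.
    suff /aQ ji : a \in Q X j by rewrite ji eqxx in ij.
    apply: (@pareto_swap k R (Q X) a b j) => // t /aQ->.
    by rewrite Qi inE yX.
  have cR : c \notin R (Q X) by rewrite eR !inE negb_or eq_sym ac.
  suff /aQ li : a \in Q X l by rewrite li eqxx in il.
  apply: (@pareto_swap k R (Q X) a c l) => // t /aQ->.
  by rewrite Qi inE yX.
(* With true ballot [X :|: B], agent [i] can obtain the approved [a] by returning to her ballot in
   [P]; so the actual winner must be approved too. *)
have no_regret (X : {set A}) y :
    a \in X -> R (Q X) = y |: B -> y \notin B -> y \in X.
  move=> aX eR yB.
  have /(@unilateral_sgsp R (Q X) P i i gR) : forall t, t != i -> P t = Q X t.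
    by move=> t ti; rewrite QE.
  rewrite RP eR !leq_hammingU1 // Qi !inE aX (negPf yB) (negPf aB) !orbF /= implybT.
  by move=> /(_ isT).
have Rab : R (Q [set a; b]) = b |: B.
  have [||//|eR] := outcome [set a; b].
  - by rewrite subsetUl.
  - by rewrite !inE eqxx orbT.
  have := no_regret [set a; b] c; rewrite !inE eqxx => /(_ isT eR cB).
  by rewrite ![c == _]eq_sym (negPf ac) (negPf bc).
have Rac : R (Q [set a; c]) = c |: B.
  have [||eR|//] := outcome [set a; c].
  - by rewrite subUset !sub1set !inE !eqxx orbT.
  - by rewrite !inE eqxx !orbT.
  have := no_regret [set a; c] b; rewrite !inE eqxx => /(_ isT eR bB).
  by rewrite [b == a]eq_sym (negPf ab) (negPf bc).
have [|eR|eR] := outcome [set a; b; c] (subxx _); first by rewrite !inE eqxx orbT.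
(* If [b] wins, dropping [b] from her ballot elects [c], which helps [l]; if [c] wins, dropping [c]
   elects [b], which helps [j]. *)
- have := @unilateral_sgsp R (Q [set a; b; c]) (Q [set a; c]) i l gR (QQ _ _).
  rewrite eR Rac !leq_hammingU1 // Qi Ql !inE !eqxx !(orbT, orTb) /=.
  by rewrite (negPf bc) (negPf bB) => /(_ isT).
- have := @unilateral_sgsp R (Q [set a; b; c]) (Q [set a; b]) i j gR (QQ _ _).
  rewrite eR Rab !leq_hammingU1 // Qi Qj !inE !eqxx !(orbT, orTb) /=.
  by rewrite [c == b]eq_sym (negPf bc) (negPf cB) => /(_ isT).
Qed.

End RuleWithCommonBase.

Lemma exists_uniq_seq (T : finType) n : n <= #|T| ->
  exists2 s : seq T, uniq s & size s = n.
Proof.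
move=> leT; exists (take n (enum T)); first exact/take_uniq/enum_uniq.
by rewrite size_takel // -cardE.
Qed.

Theorem mainTheorem2 (m k n : nat) (N A : finType)
    (hN : #|N| = n) (hA : #|A| = m)
    (hk : 1 <= k <= m - 2) (hn : 6 <= n) :
  ~ exists R : profile N A -> {set A},
      voting_rule k R /\
      strongly_group_strategyproof R /\
      pareto_efficient k R.
Proof.
case=> R [vR [gR pR]].
have [|[|i [|j [|l [|o []]]]] // uN _] := @exists_uniq_seq N 4; first lia.
(* The [k + 2] alternatives are [a], [b], [c] and the [k - 1] members of [B]; the four agents are
   one supporter for each of [a], [b], [c], and [o]. *)
have [|sA uA zA] := @exists_uniq_seq A k.+2; first lia.
case: sA uA zA => [|a [|b [|c s]]] //= uA zA; try lia.
have uABC : uniq [:: a; b; c].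
  move: uA; rewrite /= !inE !negb_or.
  by move=> /and4P[/and3P[-> -> _] /andP[-> _] _ _].
pose B := [set x in s].
have kB : k = #|B|.+1.
  rewrite cardsE (card_uniqP _) //; first lia.
  by move: uA => /= /and4P[].
have [aB bB cB] : [/\ a \notin B, b \notin B & c \notin B].
  move: uA; rewrite /= !inE !negb_or.
  by move=> /and4P[/and3P[_ _ ->] /andP[_ ->] ->].
clearbody B.
pose P : profile N A := [ffun t => if t == i then a |: B else
  if t == j then b |: B else if t == l then c |: B else B].
have := uN; rewrite /= !inE !negb_or andbT.
move=> /and3P[/and3P[ij il io] /andP[jl jo] lo].
have Pi : P i = a |: B by rewrite ffunE eqxx.
have Pj : P j = b |: B by rewrite ffunE eq_sym (negPf ij) eqxx.
have Pl : P l = c |: B by rewrite ffunE ![l == _]eq_sym (negPf il) (negPf jl) eqxx.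
have Pt t : t \notin [:: i; j; l] -> P t = B.
  by rewrite ffunE !inE !negb_or => /and3P[/negPf-> /negPf-> /negPf->].
have BP t : B \subset P t.
  by rewrite ffunE; do !case: ifP => _; rewrite ?subsetUr.
have Po : P o = B by rewrite Pt // !inE !negb_or ![o == _]eq_sym io jo lo.
have bPj : b \in P j by rewrite Pj setU11.
have [x [u [xB eR xu]]] := outcome_common_base vR pR kB Po BP bB bPj.
have : x \in [:: a; b; c].
  move: xu; rewrite ffunE !inE.
  by do !case: ifP => _; rewrite ?inE (negPf xB) ?orbF // => ->; rewrite ?orbT.
rewrite !inE => /or3P[]/eqP ex; rewrite ex in eR.
- exact: (outcome_neq_singleton vR gR pR kB uABC uN aB bB cB Pi Pj Pl Pt eR).
- apply: (outcome_neq_singleton (o := o) vR gR pR kB _ _ bB aB cB Pj Pi Pl _ eR).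
  + by rewrite (uniq_catCA [:: b] [:: a] [:: c]).
  + by rewrite (uniq_catCA [:: j] [:: i] [:: l; o]).
  + by move=> t; rewrite !inE orbCA => nt; rewrite Pt ?inE.
- apply: (outcome_neq_singleton (o := o) vR gR pR kB _ _ cB aB bB Pl Pi Pj _ eR).
  + by rewrite (uniq_catCA [:: c] [:: a; b] [::]).
  + by rewrite (uniq_catCA [:: l] [:: i; j] [:: o]).
  + by move=> t; rewrite !inE orbC -orbA => nt; rewrite Pt ?inE.
Qed.
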